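(* For every scheme $\mathbf{X}\in\mathcal{S}$, the following split interpolation property fails: for all formulas $\phi,\psi\in\mathcal{L}$, if $\mathit{At}(\phi)\cap\mathit{At}(\psi)\neq\emptyset$ and $\models_{\mathbf{X}}^{\mathbf{st}}\phi\Rightarrow\psi$, then there is a formula $\chi\in\mathcal{L}$ with $\mathit{At}(\chi)\subseteq\mathit{At}(\phi)\cap\mathit{At}(\psi)$ such that $\models_{\mathbf{X}}^{\mathbf{st}}\phi\Rightarrow\chi$ and $\models_{\mathbf{X}}^{\mathbf{tt}}\chi\Rightarrow\psi$.
   Context: Language: $\mathit{Var}$ is a countably infinite set of atoms; $\mathcal{L}$ is the set of formulas built from $\mathit{Var}$ using unary $\neg$ and binary $\wedge,\lor$ (no propositional constants). $\mathit{At}(\phi)$ is the set of atoms occurring in $\phi$. Schemes: let $\mathcal{V}=\{0,\frac12,1\}$. A scheme is a triple $\mathbf{X}=\langle f^\neg,f^\wedge,f^\lor\rangle$ of operations on $\mathcal{V}$ (of arities 1, 2, 2). An $\mathbf{X}$-valuation is a map $v:\mathcal{L}\to\mathcal{V}$ with $v(\neg\phi)=f^\neg(v(\phi))$, $v(\phi\wedge\chi)=f^\wedge(v(\phi),v(\chi))$, $v(\phi\lor\chi)=f^\lor(v(\phi),v(\chi))$ (arbitrary on atoms). All schemes considered here satisfy $f^\neg(1)=0$, $f^\neg(\frac12)=\frac12$, $f^\neg(0)=1$; $f^\wedge$ and $f^\lor$ are classical on $\{0,1\}$; $f^\wedge(1,\frac12)=f^\wedge(\frac12,1)=f^\wedge(\frac12,\frac12)=\frac12$;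 $f^\lor(0,\frac12)=f^\lor(\frac12,0)=f^\lor(\frac12,\frac12)=\frac12$. The scheme $\mathbf{X}_\wedge/\mathbf{Y}_\lor$ is determined by the remaining values: - the pair $(f^\wedge(0,\frac12),f^\wedge(\frac12,0))$ is $(\frac12,\frac12)$ for $\mathbf{WK}_\wedge$, $(0,\frac12)$ for $\mathbf{LMK}_\wedge$, $(\frac12,0)$ for $\mathbf{RMK}_\wedge$; - the pair $(f^\lor(1,\frac12),f^\lor(\frac12,1))$ is $(\frac12,\frac12)$ for $\mathbf{WK}_\lor$, $(1,\frac12)$ for $\mathbf{LMK}_\lor$, $(\frac12,1)$ for $\mathbf{RMK}_\lor$. The set $\mathcal{S}$ consists of the eight schemes $\mathbf{LMK}_{\wedge}/\mathbf{LMK}_{\lor}$, $\mathbf{LMK}_{\wedge}/\mathbf{RMK}_{\lor}$, $\mathbf{LMK}_{\wedge}/\mathbf{WK}_{\lor}$, $\mathbf{RMK}_{\wedge}/\mathbf{LMK}_{\lor}$, $\mathbf{RMK}_{\wedge}/\mathbf{RMK}_{\lor}$, $\mathbf{RMK}_{\wedge}/\mathbf{WK}_{\lor}$, $\mathbf{WK}_{\wedge}/\mathbf{LMK}_{\lor}$, $\mathbf{WK}_{\wedge}/\mathbf{RMK}_{\lor}$. Consequence: let $\mathbf{s}=\{1\}$, $\mathbf{t}=\{1,\frac12\}$. For $\mathbf{x},\mathbf{y}\in\{\mathbf{s},\mathbf{t}\}$, $\models_{\mathbf{X}}^{\mathbf{xy}}\phi\Rightarrow\psi$ means: for every $\mathbf{X}$-valuation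 $v$, if $v(\phi)\in\mathbf{x}$ then $v(\psi)\in\mathbf{y}$. *)

(* Defs.v *)
From mathcomp Require Import all_boot finmap.

Set Implicit Arguments.
Unset Strict Implicit.
Unset Printing Implicit Defensive.

Local Open Scope fset_scope.

(* The countably infinite set of atoms is nat. *)
Inductive formula : Type :=
| Atom of nat
| Neg of formula
| And of formula & formula
| Or of formula & formula.

Fixpoint At (phi : formula) : {fset nat} :=
  match phi with
  | Atom p => [fset p]
  | Neg a => At a
  | And a b | Or a b => At a `|` At b
  end.

(* V0, Vh, V1 stand for 0, 1/2, 1. *)
Inductive tv : Type := V0 | Vh | V1.

Record scheme : Type := Scheme {
  fneg : tv -> tv;
  fand : tv -> tv -> tv;
  for_ : tv -> tv -> tv
}.

Definition valuation (X : scheme) (v : formula -> tv) : Prop :=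
  [/\ forall phi, v (Neg phi) = fneg X (v phi),
      forall phi chi, v (And phi chi) = fand X (v phi) (v chi)
    & forall phi chi, v (Or phi chi) = for_ X (v phi) (v chi)].

Definition negK (x : tv) : tv :=
  match x with V0 => V1 | Vh => Vh | V1 => V0 end.

(* Weak, left middle and right middle Kleene. *)
Inductive kleene : Type := WK | LMK | RMK.

Definition andK (k : kleene) (x y : tv) : tv :=
  match x, y with
  | V1, V1 => V1
  | V0, V0 | V0, V1 | V1, V0 => V0
  | V0, Vh => match k with LMK => V0 | WK | RMK => Vh end
  | Vh, V0 => match k with RMK => V0 | WK | LMK => Vh end
  | V1, Vh | Vh, V1 | Vh, Vh => Vh
  end.

Definition orK (k : kleene) (x y : tv) : tv :=
  match x, y with
  | V0, V0 => V0
  | V1, V1 | V0, V1 | V1, V0 => V1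
  | V1, Vh => match k with LMK => V1 | WK | RMK => Vh end
  | Vh, V1 => match k with RMK => V1 | WK | LMK => Vh end
  | V0, Vh | Vh, V0 | Vh, Vh => Vh
  end.

Definition mixed (k l : kleene) : scheme := Scheme negK (andK k) (orK l).

(* All combinations except WK/WK. *)
Inductive calS : scheme -> Prop :=
| S_LMK_LMK : calS (mixed LMK LMK)
| S_LMK_RMK : calS (mixed LMK RMK)
| S_LMK_WK : calS (mixed LMK WK)
| S_RMK_LMK : calS (mixed RMK LMK)
| S_RMK_RMK : calS (mixed RMK RMK)
| S_RMK_WK : calS (mixed RMK WK)
| S_WK_LMK : calS (mixed WK LMK)
| S_WK_RMK : calS (mixed WK RMK).

Inductive standard : Type := strict | tolerant.

(* The designated set of a standard: s = {1}, t = {1, 1/2}. *)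
Definition designated (x : standard) (a : tv) : Prop :=
  match x with
  | strict => a = V1
  | tolerant => a = V1 \/ a = Vh
  end.

Definition entails (X : scheme) (x y : standard) (phi psi : formula) : Prop :=
  forall v, valuation X v -> designated x (v phi) -> designated y (v psi).

Definition split_interpolation (X : scheme) : Prop :=
  forall phi psi : formula,
    At phi `&` At psi != fset0 ->
    entails X strict tolerant phi psi ->
    exists chi : formula,
      [/\ At chi `<=` At phi `&` At psi,
          entails X strict tolerant phi chi
        & entails X tolerant tolerant chi psi].

(* Main.v *)
From mathcomp Require Import all_boot finmap.
Require Import Defs.

(** In every scheme considered the value 1/2 is a fixed point of all three
    connectives, so a formula all of whose atoms are undetermined is itself
    undetermined, hence tolerantly true.  Let [p] be the only atom shared by
    premise and conclusion.  At a valuation giving [p] the value 1/2 every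
    candidate interpolant has value 1/2, so the tolerant-to-tolerant half of
    interpolation forbids the conclusion from being 0 there
    ([split_interpolation_nonfalse]).

    The other half costs nothing: take as premise [p] and not [p], which never
    has value 1 and so strict-tolerantly entails anything.  It remains to find a
    conclusion mentioning [p] that can be 0 while [p] is 1/2.  Such a formula
    exists as soon as one of the two binary connectives ignores an undetermined
    argument on one side ([calS_gap_refutable]); only the purely weak scheme,
    where 1/2 is infectious, lacks one. *)

Set Implicit Arguments.
Unset Strict Implicit.
Unset Printing Implicit Defensive.

Local Open Scope fset_scope.

Fixpoint eval (X : scheme) (e : nat -> tv) (phi : formula) : tv :=
  match phi with
  | Atom p => e p
  | Neg a => fneg X (eval X e a)
  | And a b => fand X (eval X e a) (eval X e b)
  | Or a b => for_ X (eval X e a) (eval X e b)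
  end.

Lemma eval_valuation X e : valuation X (eval X e).
Proof. by split. Qed.

Lemma calS_mixed X : calS X -> exists k l, X = mixed k l.
Proof. by case; do 2 eexists. Qed.

Lemma valuation_gap k l v phi : valuation (mixed k l) v ->
  (forall p, p \in At phi -> v (Atom p) = Vh) -> v phi = Vh.
Proof.
move=> [vN vA vO]; elim: phi => [p|a IHa|a IHa b IHb|a IHa b IHb] /= vh.
- by apply: vh; rewrite inE.
- by rewrite vN IHa.
- by rewrite vA IHa ?IHb // => p pin; apply: vh; rewrite inE pin ?orbT.
- by rewrite vO IHa ?IHb // => p pin; apply: vh; rewrite inE pin ?orbT.
Qed.

Definition contradiction (p : nat) : formula := And (Atom p) (Neg (Atom p)).

Lemma contradiction_entails k l p y psi :
  entails (mixed k l) strict y (contradiction p) psi.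
Proof. by move=> v [vN vA _] /=; rewrite vA vN /=; case: (v (Atom p)). Qed.

(** An interpolant between a contradiction in [p] and [psi] can mention [p]
    only, so it is 1/2, and thus tolerantly true, whenever [p] is. *)
Lemma split_interpolation_nonfalse k l p psi v :
  split_interpolation (mixed k l) -> p \in At psi ->
  valuation (mixed k l) v -> v (Atom p) = Vh -> v psi <> V0.
Proof.
move=> interp p_psi val_v vp.
have AtC : At (contradiction p) = [fset p] by rewrite /= fsetUid.
have shared : At (contradiction p) `&` At psi != fset0.
  by apply/fset0Pn; exists p; rewrite AtC !inE eqxx.
have [chi [chi_sub _ chi_psi]] :=
  interp _ _ shared (@contradiction_entails k l p tolerant psi).
have chi_h : v chi = Vh.
  apply: (valuation_gap val_v) => q /(fsubsetP chi_sub).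
  by rewrite AtC !inE => /andP[/eqP-> _].
by case: (chi_psi v val_v); [rewrite chi_h; right| move=> -> | move=> ->].
Qed.

(** With [Atom 1] put first for a left middle connective and second for a right
    middle one, its value 0 decides the conjunction; for a disjunction the dual
    value 1 decides, so the formula is negated. *)
Lemma calS_gap_refutable X : calS X ->
  exists psi e, [/\ 0 \in At psi, e 0 = Vh & eval X e psi = V0].
Proof.
pose e b n := if n is 0 then Vh else b.
case.
1-3: by exists (And (Atom 1) (Atom 0)), (e V0); split; rewrite // !inE.
1-3: by exists (And (Atom 0) (Atom 1)), (e V0); split; rewrite // !inE.
- by exists (Neg (Or (Atom 1) (Atom 0))), (e V1); split; rewrite // !inE.
- by exists (Neg (Or (Atom 0) (Atom 1))), (e V1); split; rewrite // !inE.
Qed.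

Theorem theorem4p14 (X : scheme) (hX : calS X) : ~ split_interpolation X.
Proof.
have [psi [e [psi0 e0 psi_false]]] := calS_gap_refutable hX.
have [k [l eX]] := calS_mixed hX; rewrite {hX}eX in psi_false *.
move=> interp.
exact: (split_interpolation_nonfalse interp psi0 (eval_valuation _ e) e0).
Qed.
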